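(* Let $P,Q,t_0,t_1\in\mathbb{R}$ with $Q\ne0$, and let $(T_n)_{n\in\mathbb{Z}}$ be the second-order linear sequence with $T_{n+2}=PT_{n+1}-QT_n$ for all $n\in\mathbb{Z}$ and $(T_0,T_1)=(t_0,t_1)$; assume $T_n\neq0$ for all $n$. Let $B=B(x)$ be the solution of the Riccati equation $$B'=\frac{P}{Q}B(B-P)+P,\qquad B(0)=0.$$ Then a solution of the Cauchy problem for the Volterra lattice $$\frac{\partial Y_n}{\partial x}=Y_n\left(Y_{n+1}-Y_{n-1}\right)\qquad(n\in\mathbb{Z})$$ with initial data $$Y_n(0)=\frac{T_nT_{n+3}}{T_{n+1}T_{n+2}}$$ is given (wherever the expressions are defined) by $$Y_n(x)=\frac{\left(T_n-T_{n-1}B(x)\right)\left(T_{n+3}-T_{n+2}B(x)\right)}{\left(T_{n+1}-T_nB(x)\right)\left(T_{n+2}-T_{n+1}B(x)\right)}.$$ *)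

(* Defs.v *)
From Stdlib Require Export Reals ZArith.
From Coquelicot Require Export Coquelicot.
Open Scope R_scope.

Definition linear_seq (P Q t0 t1 : R) (T : Z -> R) : Prop :=
  (forall n : Z, T (n + 2)%Z = P * T (n + 1)%Z - Q * T n) /\
  T 0%Z = t0 /\ T 1%Z = t1.

(** [D] is the set of real [x] at which [B x] is defined. It is not required to
    be an interval, so that solutions continued beyond a pole are covered. *)
Definition riccati_solution (P Q : R) (D : R -> Prop) (B : R -> R) : Prop :=
  open D /\ D 0 /\ B 0 = 0 /\
  forall x : R, D x -> is_derive B x (P / Q * B x * (B x - P) + P).

(** The components of a solution are partial functions of [x]: [Y n] is only
    meaningful on the open set [dom n], and the [n]-th equation is required
    wherever the three components occurring in it are defined. *)
Definition volterra_cauchy_solution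
    (y0 : Z -> R) (dom : Z -> R -> Prop) (Y : Z -> R -> R) : Prop :=
  (forall n : Z, open (dom n)) /\
  (forall n : Z, dom n 0 /\ Y n 0 = y0 n) /\
  (forall (n : Z) (x : R),
     dom (n - 1)%Z x -> dom n x -> dom (n + 1)%Z x ->
     is_derive (Y n) x (Y n x * (Y (n + 1)%Z x - Y (n - 1)%Z x))).

Definition initial_Y (T : Z -> R) (n : Z) : R :=
  (T n * T (n + 3)%Z) / (T (n + 1)%Z * T (n + 2)%Z).

Definition explicit_Y (T : Z -> R) (B : R -> R) (n : Z) (x : R) : R :=
  ((T n - T (n - 1)%Z * B x) * (T (n + 3)%Z - T (n + 2)%Z * B x)) /
  ((T (n + 1)%Z - T n * B x) * (T (n + 2)%Z - T (n + 1)%Z * B x)).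

(** Division on [R] is total, so the domain of [explicit_Y] has to be stated. *)
Definition explicit_Y_dom (T : Z -> R) (D : R -> Prop) (B : R -> R)
    (n : Z) (x : R) : Prop :=
  D x /\
  (T (n + 1)%Z - T n * B x) * (T (n + 2)%Z - T (n + 1)%Z * B x) <> 0.

(* Main.v *)
(** With [u k := T k - T (k - 1) * B] one has [Y n = u n * u (n + 3) / (u (n + 1) * u (n + 2))],
    and [u] satisfies the same recurrence as [T].  Put
    [c k := T (k - 1) * T (k + 1) - T k ^ 2] and [d k := u (k - 1) * u (k + 1) - u k ^ 2].
    The Riccati equation says exactly [B' * c k = P * d k], while the logarithmic derivative of
    [Y n] is [B' * (c (n + 2) / (u (n + 2) * u (n + 3)) - c n / (u n * u (n + 1)))].
    By the recurrence the two terms become [Y (n + 1) - 1] and [Y (n - 1) - 1]. *)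
Require Import Defs.
From Stdlib Require Import Reals ZArith Lia.
From Coquelicot Require Import Coquelicot.
Open Scope R_scope.

(** Gives openness of [explicit_Y_dom]; continuity is assumed only on [D], where [B] is
    differentiable. *)
Lemma open_and_neq0 (D : R -> Prop) (f : R -> R) :
  open D -> (forall x, D x -> continuous f x) ->
  open (fun x => D x /\ f x <> 0).
Proof.
  intros HD Hf x [Dx fx].
  apply filter_and; [exact (HD x Dx)|].
  apply (Hf x Dx (fun y => y <> 0)).
  exact (open_neq 0 (f x) fx).
Qed.

(** Quotient rule with [u k] having derivative [- T (k - 1) * b']; the slope [b'] is still
    arbitrary. *)
Lemma is_derive_explicit_Y (T : Z -> R) (B : R -> R) (n : Z) (x b' : R) :
  is_derive B x b' ->
  let u k := T k - T (k - 1)%Z * B x in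
  u (n + 1)%Z <> 0 -> u (n + 2)%Z <> 0 ->
  is_derive (explicit_Y T B n) x
    (- b' * ((T (n - 1)%Z * u (n + 3)%Z + u n * T (n + 2)%Z) /
               (u (n + 1)%Z * u (n + 2)%Z)
             - u n * u (n + 3)%Z *
               (T n * u (n + 2)%Z + u (n + 1)%Z * T (n + 1)%Z) /
               (u (n + 1)%Z * u (n + 2)%Z) ^ 2)).
Proof.
  intros HB u.
  unfold u.
  replace (n + 1 - 1)%Z with n by lia.
  replace (n + 2 - 1)%Z with (n + 1)%Z by lia.
  replace (n + 3 - 1)%Z with (n + 2)%Z by lia.
  intros H1 H2.
  assert (exB : ex_derive B x) by (exists b'; exact HB).
  unfold explicit_Y.
  auto_derive.
  - repeat split; auto using Rmult_integral_contrapositive_currified.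
  - change (Derive (fun y : R => B y) x) with (Derive B x).
    rewrite (is_derive_unique B x b' HB).
    field; split; assumption.
Qed.

(** Here [ai] stands for [T (n - 2 + i)]. The Riccati right-hand side is [P / Q] times the
    characteristic polynomial [B ^ 2 - P * B + Q], and [d k = c k * (B ^ 2 - P * B + Q) / Q] for
    every [k]. *)
Lemma volterra_identity (P Q B a0 a1 a2 a3 a4 a5 a6 : R) :
  Q <> 0 ->
  a2 = P * a1 - Q * a0 -> a3 = P * a2 - Q * a1 -> a4 = P * a3 - Q * a2 ->
  a5 = P * a4 - Q * a3 -> a6 = P * a5 - Q * a4 ->
  a2 - a1 * B <> 0 -> a3 - a2 * B <> 0 -> a4 - a3 * B <> 0 -> a5 - a4 * B <> 0 ->
  - (P / Q * B * (B - P) + P) *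
    ((a1 * (a5 - a4 * B) + (a2 - a1 * B) * a4) / ((a3 - a2 * B) * (a4 - a3 * B))
     - (a2 - a1 * B) * (a5 - a4 * B) *
       (a2 * (a4 - a3 * B) + (a3 - a2 * B) * a3) /
       ((a3 - a2 * B) * (a4 - a3 * B)) ^ 2)
  = (a2 - a1 * B) * (a5 - a4 * B) / ((a3 - a2 * B) * (a4 - a3 * B)) *
    ((a3 - a2 * B) * (a6 - a5 * B) / ((a4 - a3 * B) * (a5 - a4 * B))
     - (a1 - a0 * B) * (a4 - a3 * B) / ((a2 - a1 * B) * (a3 - a2 * B))).
Proof.
  intros HQ E2 E3 E4 E5 E6 H2 H3 H4 H5.
  (* Eliminating from the top index down leaves a rational identity in [P], [Q], [B], [a0], [a1]. *)
  subst a6 a5 a4 a3 a2.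
  field.
  repeat split; assumption.
Qed.

Theorem corollary7p3
  (P Q t0 t1 : R) (HQ : Q <> 0)
  (T : Z -> R) (HT : linear_seq P Q t0 t1 T)
  (HTnz : forall n : Z, T n <> 0)
  (D : R -> Prop) (B : R -> R) (HB : riccati_solution P Q D B) :
  volterra_cauchy_solution
    (initial_Y T) (explicit_Y_dom T D B) (explicit_Y T B).
Proof.
  destruct HT as [Hrec _].
  destruct HB as [HD [HD0 [HB0 HB']]].
  split; [|split].
  - intros n.
    apply open_and_neq0; [exact HD|].
    intros x Dx.
    assert (exB : ex_derive B x) by (eexists; exact (HB' x Dx)).
    apply (ex_derive_continuous (V := R_NormedModule)).
    auto_derive; auto.
  - intros n.
    unfold explicit_Y_dom, explicit_Y, initial_Y.
    rewrite HB0.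
    repeat split.
    + exact HD0.
    + rewrite !Rmult_0_r, !Rminus_0_r.
      apply Rmult_integral_contrapositive_currified; apply HTnz.
    + rewrite !Rmult_0_r, !Rminus_0_r; reflexivity.
  - intros n x [Dx Hm] [_ _] [_ Hp].
    (* The domains at [n - 1] and [n + 1] make [u n], ..., [u (n + 3)] nonzero: all the denominators
       of the equation. *)
    pose proof (Rmult_neq_0_reg _ _ Hm) as [Hu0 Hu1].
    pose proof (Rmult_neq_0_reg _ _ Hp) as [Hu2 Hu3].
    pose proof (is_derive_explicit_Y T B n x _ (HB' x Dx)) as Hder.
    pose proof (Hrec (n - 2)%Z) as E2.
    pose proof (Hrec (n - 1)%Z) as E3.
    pose proof (Hrec n) as E4.
    pose proof (Hrec (n + 1)%Z) as E5.
    pose proof (Hrec (n + 2)%Z) as E6.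
    cbv beta zeta in Hder.
    (* The first occurrence, under [is_derive], stays folded to match [Hder]. *)
    unfold explicit_Y at 2 3 4.
    replace (n - 2 + 2)%Z with n in * by lia.
    replace (n - 2 + 1)%Z with (n - 1)%Z in * by lia.
    replace (n - 1 - 1)%Z with (n - 2)%Z in * by lia.
    replace (n - 1 + 1)%Z with n in * by lia.
    replace (n - 1 + 2)%Z with (n + 1)%Z in * by lia.
    replace (n - 1 + 3)%Z with (n + 2)%Z in * by lia.
    replace (n + 1 - 1)%Z with n in * by lia.
    replace (n + 1 + 1)%Z with (n + 2)%Z in * by lia.
    replace (n + 1 + 2)%Z with (n + 3)%Z in * by lia.
    replace (n + 1 + 3)%Z with (n + 4)%Z in * by lia.
    replace (n + 2 - 1)%Z with (n + 1)%Z in * by lia.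
    replace (n + 2 + 1)%Z with (n + 3)%Z in * by lia.
    replace (n + 2 + 2)%Z with (n + 4)%Z in * by lia.
    replace (n + 3 - 1)%Z with (n + 2)%Z in * by lia.
    rewrite <- (volterra_identity P Q (B x) _ _ _ _ _ _ _ HQ E2 E3 E4 E5 E6 Hu0 Hu1 Hu2 Hu3).
    exact (Hder Hu1 Hu2).
Qed.
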